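(* Let $P=\{1423\}$. For $n\ge2$ and integer $l$, let $c_{n,l}$ be the number of $l$-clusters relative to $P$ whose permutation has length $n$ (with $c_{n,l}=0$ for $l\le0$), and set $c_{1,l}=\delta_{0,l}$. Then $c_{2,l}=c_{3,l}=0$ for all $l$, and for all $n\ge4$ and all $l$, $$c_{n,l}=\sum_{k\ge1,\ 2k+2\le n}\binom{n-k-2}{k}\,c_{n-2k-1,\,l-k}.$$ Consequently, if $\pi_{n,k}$ is the number of permutations of length $n$ with exactly $k$ occurrences of $1423$ and $\Pi(x,t)=\sum_{n,k}\pi_{n,k}\frac{x^n}{n!}t^k$, then $$\Pi(x,t)=\Big(1-x-\sum_{n\ge2,\,l\ge1}\frac{c_{n,l}\,x^n(t-1)^l}{n!}\Big)^{-1}.$$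
   Context: A permutation of length $n$ is a sequence containing each of $1,\dots,n$ exactly once. For a sequence $s$ of distinct integers, $\mathrm{st}(s)$ is the unique permutation with the same relative order of entries. An occurrence of a pattern $\pi$ in $\sigma$ is a consecutive segment $\sigma_i\cdots\sigma_j$ with $\mathrm{st}(\sigma_i\cdots\sigma_j)=\pi$. For a set $P$ of patterns, a $q$-cluster ($q\ge1$) is a tuple $(\sigma,\pi_1,\dots,\pi_q,i_1,\dots,i_q)$ with $\sigma$ a permutation of length $n$, $\pi_k\in P$ of length $r_k$, such that $\mathrm{st}(\sigma_{i_k}\cdots\sigma_{i_k+r_k-1})=\pi_k$ for all $k$, $i_k<i_{k+1}<i_k+r_k$ for $k<q$, $i_1=1$ and $n=i_q+r_q-1$. $\delta$ is the Kronecker delta. *)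

(* Defs.v *)
From HB Require Import structures.
From mathcomp Require Import all_boot all_order all_fingroup all_algebra.
From mathcomp Require Import zify.
Set Implicit Arguments.
Unset Strict Implicit.
Unset Printing Implicit Defensive.
Import GRing.Theory.

(** Words are [seq nat]; entries and positions in words are counted from 1. *)

Definition is_perm_word (n : nat) (s : seq nat) : bool := perm_eq s (iota 1 n).

Definition word (n : nat) (s : 'S_n) : seq nat := [seq (s i).+1 | i <- enum 'I_n].

(** Each entry is replaced by its rank; [st_perm], [st_order] and [st_unique]
    show that this is the unique permutation with the same relative order. *)
Definition st (s : seq nat) : seq nat := [seq count (leq^~ x) s | x <- s].

Definition same_order (s t : seq nat) : Prop :=
  size s = size t /\
  forall i j, i < size s -> j < size s ->
    (nth 0 s i < nth 0 s j) = (nth 0 t i < nth 0 t j).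

Definition occurs_at (pi s : seq nat) (i : nat) : bool :=
  (0 < i) && (st (take (size pi) (drop i.-1 s)) == pi).

Definition nocc (pi s : seq nat) : nat := count (occurs_at pi s) (iota 1 (size s)).

(** Here [pis = (pi_1, ..., pi_q)] and [pos = (i_1, ..., i_q)], so that the
    tuple component of index [k] is [nth _ _ k.-1]. *)
Definition is_cluster (P : seq (seq nat)) (s : seq nat)
    (pis : seq (seq nat)) (pos : seq nat) : bool :=
  let q := size pis in
  let pi k := nth [::] pis k in
  let i k := nth 0 pos k in
  [&& 0 < q, size pos == q, is_perm_word (size s) s, all (mem P) pis,
      all (fun k => occurs_at (pi k) s (i k)) (iota 0 q),
      all (fun k => i k < i k.+1 < i k + size (pi k)) (iota 0 q.-1),
      i 0 == 1 &
      size s == i q.-1 + size (pi q.-1) - 1].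

(** Positions range over [0 .. n]; all positions of a cluster of length [n] lie
    in [1 .. n] as soon as the patterns in [P] are nonempty. *)
Definition num_clusters (P : seq (seq nat)) (n q : nat) : nat :=
  #|[set c : 'S_n * q.-tuple (seq_sub P) * q.-tuple 'I_n.+1 |
      is_cluster P (word c.1.1) (map val c.1.2) (map val c.2)]|.

Definition num_perms_occ (pi : seq nat) (n k : nat) : nat :=
  #|[set s : 'S_n | nocc pi (word s) == k]|.

Definition p1423 : seq nat := [:: 1; 4; 2; 3].

Definition c1423 (n : nat) (l : int) : nat :=
  if n == 1 then (l == 0%R) : nat
  else if l is Posz q.+1 then num_clusters [:: p1423] n q.+1 else 0.

(** Formal power series in [x] over [R], as coefficient sequences. *)

Section FPS.
Variable R : comUnitRingType.
Implicit Types d e : nat -> R.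
Local Open Scope ring_scope.

Definition fps1 : nat -> R := fun n => (n == 0)%N%:R.
Definition fpsX : nat -> R := fun n => (n == 1)%N%:R.
Definition fps_mul d e : nat -> R := fun n => \sum_(i < n.+1) d i * e (n - i)%N.

(** The first [n] coefficients of the inverse, from
    [d_0 e_n = - (d_n e_0 + ... + d_1 e_(n-1))]. *)
Fixpoint fps_invs d (n : nat) : seq R :=
  if n is m.+1 then
    let e := fps_invs d m in
    rcons e (if m is 0 then (d 0)^-1
             else - (d 0)^-1 * \sum_(j < m) d (m - j)%N * e`_j)
  else [::].

Definition fps_inv d : nat -> R := fun n => (fps_invs d n.+1)`_n.

Lemma size_fps_invs d n : size (fps_invs d n) = n.
Proof. by elim: n => //= n IH; rewrite size_rcons IH. Qed.

Lemma nth_fps_invs d n m : (m < n)%N -> (fps_invs d n)`_m = fps_inv d m.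
Proof.
elim: n => // n IH; rewrite ltnS leq_eqVlt => /orP[/eqP-> //|lmn].
by rewrite -IH // /= nth_rcons size_fps_invs lmn.
Qed.

Lemma fps_inv0 d : fps_inv d 0 = (d 0)^-1.
Proof. by []. Qed.

Lemma fps_invS d n :
  fps_inv d n.+1 =
  - (d 0)^-1 * \sum_(j < n.+1) d (n.+1 - j)%N * fps_inv d j.
Proof.
rewrite {1}/fps_inv -[fps_invs d n.+2]/(rcons (fps_invs d n.+1)
  (- (d 0)^-1 * \sum_(j < n.+1) d (n.+1 - j)%N * (fps_invs d n.+1)`_j)).
rewrite nth_rcons size_fps_invs ltnn eqxx.
by congr (_ * _); apply: eq_bigr => j _; rewrite nth_fps_invs.
Qed.

Lemma fps_mulC d e : fps_mul d e =1 fps_mul e d.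
Proof.
move=> n; rewrite /fps_mul (reindex_inj rev_ord_inj) /=.
by apply: eq_bigr => i _; rewrite mulrC subSS subKn // -ltnS.
Qed.

Lemma fps_mulVr d : d 0 \is a GRing.unit -> fps_mul (fps_inv d) d =1 fps1.
Proof.
move=> du [|n]; rewrite /fps_mul /fps1.
  by rewrite big_ord1 fps_inv0 subn0 mulVr.
rewrite big_ord_recr /= subnn fps_invS mulrC mulrA mulrN divrr // mulN1r.
by apply/eqP; rewrite subr_eq0; apply/eqP/eq_bigr => i _; rewrite mulrC.
Qed.

Lemma fps_inv_unique d e : d 0 \is a GRing.unit ->
  fps_mul e d =1 fps1 -> e =1 fps_inv d.
Proof.
move=> du de n; elim/ltn_ind: n => n IH.
have := de n; rewrite -(fps_mulVr du n) /fps_mul !big_ord_recr /= subnn.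
under eq_bigr => i _ do rewrite IH //.
by move/addrI/(mulIr du).
Qed.

End FPS.

(** Generating functions, as power series in [x] over [rat[t]] with [t = 'X].
    The inner sums over [k] and [l] are cut at [n], which loses no term:
    see [num_perms_occ_gt] and [c1423_gt]. *)

Definition Pi1423 : nat -> {poly rat} := fun n =>
  ((n`!%:R)^-1 *: \sum_(0 <= k < n.+1) (num_perms_occ p1423 n k)%:R *: 'X^k)%R.

Definition C1423 : nat -> {poly rat} := fun n =>
  (if (2 <= n)%N then
     (n`!%:R)^-1 *: \sum_(1 <= l < n.+1) (c1423 n l%:Z)%:R *: ('X - 1) ^+ l
   else 0)%R.

Lemma size_word n (s : 'S_n) : size (word s) = n.
Proof. by rewrite size_map size_enum_ord. Qed.

Lemma word_perm n (s : 'S_n) : is_perm_word n (word s).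
Proof.
have u : uniq (word s).
  by rewrite map_inj_uniq ?enum_uniq // => i j [] /ord_inj /perm_inj.
apply: uniq_perm => //; first exact: iota_uniq.
apply: (uniq_min_size u _ _).2; last by rewrite size_word size_iota.
by move=> x /mapP[i _ ->]; rewrite mem_iota add1n !ltnS leq0n ltn_ord.
Qed.

Lemma word_inj n : injective (@word n).
Proof.
move=> s t st_eq; apply/permP => i; apply/ord_inj/succn_inj.
have /eq_in_map := st_eq; apply; exact: mem_enum.
Qed.

Lemma size_st s : size (st s) = size s.
Proof. exact: size_map. Qed.

Lemma st_id n s : is_perm_word n s -> st s = s.
Proof.
move=> ps; rewrite /st -[RHS]map_id; apply/eq_in_map => x.
rewrite (perm_mem ps) mem_iota add1n => /andP[x0 xn].
rewrite (seq.permP ps) -size_filter.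
have -> : [seq y <- iota 1 n | y <= x] = iota 1 x.
  have -> : n = x + (n - x) by lia.
  rewrite iotaD filter_cat (_ : filter _ (iota 1 x) = iota 1 x); last first.
    by apply/all_filterP/allP => y; rewrite mem_iota; lia.
  rewrite (_ : filter _ _ = [::]) ?cats0 //.
  by apply/eqP; rewrite -[_ == _]negbK -has_filter; apply/hasPn => y; rewrite mem_iota; lia.
exact: size_iota.
Qed.

Lemma st_ltn s x y : x \in s -> y \in s ->
  (count (leq^~ x) s < count (leq^~ y) s) = (x < y).
Proof.
move=> xs ys.
have mono a b : a <= b -> count (leq^~ a) s <= count (leq^~ b) s.
  by move=> ab; apply: sub_count => z /= za; apply: leq_trans za ab.
case: (ltnP x y) => xy; last by rewrite ltnNge mono.
have -> : count (leq^~ y) s =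
   count (leq^~ x) s + count (fun z => x < z <= y) s.
  elim: {xs ys mono} s => //= z s ->; lia.
by rewrite -addn1 leq_add2l -has_count; apply/hasP; exists y; rewrite // xy leqnn.
Qed.

Lemma st_order s : same_order (st s) s.
Proof.
split; first exact: size_st.
move=> i j; rewrite size_st => li lj.
by rewrite !(nth_map 0) // st_ltn ?mem_nth.
Qed.

Lemma st_perm s : uniq s -> is_perm_word (size s) (st s).
Proof.
move=> us; have u : uniq (st s).
  rewrite map_inj_in_uniq // => x y xs ys e.
  by case: (ltngtP x y) => //; rewrite -(@st_ltn s) // e ltnn.
apply: uniq_perm => //; first exact: iota_uniq.
apply: (uniq_min_size u _ _).2; last by rewrite size_st size_iota.
move=> x /mapP[y ys ->]; rewrite mem_iota add1n ltnS count_size andbT.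
by rewrite -has_count; apply/hasP; exists y.
Qed.

Lemma st_unique n s p : is_perm_word n p -> same_order p s -> p = st s.
Proof.
move=> pp [sz ord]; rewrite -[LHS](st_id pp).
apply: (@eq_from_nth _ 0); rewrite !size_st // => i li.
rewrite !(nth_map 0) -?sz //.
rewrite -{2}(mkseq_nth 0 p) -{2}(mkseq_nth 0 s) -sz /mkseq !count_map.
apply: eq_in_count => j; rewrite mem_iota add0n /= => lj.
by rewrite leqNgt ord // -leqNgt.
Qed.

Lemma cluster_size P s pis pos : is_cluster P s pis pos ->
  size pis <= nth 0 pos (size pis).-1.
Proof.
case/and5P=> q0 _ _ _ /and4P[_ /allP mono /eqP p0 _].
suff H k : k < size pis -> k < nth 0 pos k by have := H (size pis).-1; lia.
elim: k => [|k IH] kq; first by rewrite p0.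
have /andP[lt _] : _ && _ := mono k ltac:(rewrite mem_iota; lia).
exact: leq_ltn_trans (IH (ltnW kq)) lt.
Qed.

Lemma num_clusters_gt P n q : n < q -> num_clusters P n q = 0.
Proof.
move=> nq; apply: eq_card0 => -[[s pis] pos]; rewrite inE /=.
apply/negP => /cluster_size; rewrite size_map size_tuple.
rewrite (nth_map ord0) ?size_tuple; last by case: q nq pis pos.
by move=> /(leq_trans nq) /leq_trans /(_ (leq_ord _)); rewrite ltnn.
Qed.

Lemma c1423_gt n (l : nat) : n < l -> c1423 n l%:Z = 0.
Proof.
rewrite /c1423; case: eqP => [->|_]; first by case: l.
by case: l => // l /num_clusters_gt.
Qed.

Lemma num_perms_occ_gt pi n k : n < k -> num_perms_occ pi n k = 0.
Proof.
move=> nk; apply: eq_card0 => s; rewrite inE; apply/negP => /eqP e.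
by have := count_size (occurs_at pi (word s)) (iota 1 (size (word s)));
   rewrite -/(nocc _ _) e size_iota size_word leqNgt nk.
Qed.

(* Main.v *)
Require Import Defs.
From mathcomp Require Import all_boot all_order all_fingroup all_algebra.
From mathcomp Require Import zify.
Set Implicit Arguments.
Unset Strict Implicit.
Unset Printing Implicit Defensive.
Import GRing.Theory.

(** Count a single letter as a trivial cluster.  Then a cluster of a pattern [p]
    on a word [s] is an occurrence at the start of [s] followed by a smaller
    cluster on [drop d s] for some [1 <= d < size p].

    Put [t = 1 + y].  Choosing which occurrences to mark, and splitting off the
    cluster of marked occurrences that contains the first letter, gives
    [t^nocc(s) = sum_(m >= 1) K(take m s) t^nocc(drop m s)], where [K] is the
    generating polynomial in [y] of the clusters on a word.  Averaging over all
    permutations makes prefix and suffix independent, which turns this identity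
    into [Pi = 1 + (x + C) Pi].

    Occurrences of 1423 overlap in at most two letters, so [d] is 2 or 3, and
    the first letter of a cluster is its minimum.  If [g n q j] counts the
    clusters with [q] occurrences on permutations of length [n] whose second
    letter is less than [j], removing the first two letters gives
    [g n (q+1) j = sum_(1 <= v < j-1) (g (n-2) q v + [v > 2] c (n-3) q)],
    which iterated hockey-stick sums solve. *)

(** * Occurrences and clusters on a word *)

Definition order_invariant (T : Type) (F : seq nat -> T) : Prop :=
  forall (f : nat -> nat) s, {in s &, {mono f : x y / x < y}} ->
    F (map f s) = F s.

Lemma order_invariant_take T n (F : seq nat -> T) :
  order_invariant F -> order_invariant (F \o take n).
Proof.
move=> F_inv f s f_mono /=; rewrite -map_take F_inv // => x y.
by move=> /mem_take xs /mem_take ys; apply: f_mono.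
Qed.

Lemma order_invariant_drop T n (F : seq nat -> T) :
  order_invariant F -> order_invariant (F \o drop n).
Proof.
move=> F_inv f s f_mono /=; rewrite -map_drop F_inv // => x y.
by move=> /mem_drop xs /mem_drop ys; apply: f_mono.
Qed.

Lemma order_invariant_st : order_invariant st.
Proof.
move=> f s f_mono; rewrite /st -map_comp; apply/eq_in_map => x xs /=.
rewrite count_map; apply: eq_in_count => y ys /=.
by rewrite leqNgt f_mono // -leqNgt.
Qed.

Definition starts_with (p s : seq nat) : bool := st (take (size p) s) == p.

(* When [1 < size p], an occurrence of [p] that ends [s] is followed, at distance
   [size p - 1], by the trivial cluster formed by the last letter of [s]. *)
Fixpoint clusters_on (p : seq nat) (q : nat) (s : seq nat) : nat :=
  if q is q'.+1 then
    starts_with p s * \sum_(1 <= d < size p) clusters_on p q' (drop d s)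
  else size s == 1.

Section WordClusters.
Variable p : seq nat.

Lemma starts_with_size s : starts_with p s -> size p <= size s.
Proof.
by move=> /eqP/(congr1 size); rewrite size_st size_take_min => /minn_idPl.
Qed.

Lemma starts_with_take m s :
  starts_with p (take m s) = starts_with p s && (size p <= m).
Proof.
case: (leqP (size p) m) => [pm|mp]; first by rewrite /starts_with take_takel ?andbT.
rewrite andbF; apply: contraTF mp => /starts_with_size.
by rewrite size_take_min; lia.
Qed.

Lemma starts_with_factor d m s : d <= m ->
  starts_with p (drop d (take m s)) =
  starts_with p (drop d s) && (d + size p <= m).
Proof.
by move=> dm; rewrite -{1}(subnK dm) -take_drop starts_with_take leq_subRL.
Qed.

Lemma order_invariant_starts_with : order_invariant (starts_with p).
Proof.
move=> f s f_mono; rewrite /starts_with.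
by have /= -> := order_invariant_take (size p) order_invariant_st f_mono.
Qed.

Lemma occurs_atE s i :
  occurs_at p s i = (0 < i) && starts_with p (drop i.-1 s).
Proof. by []. Qed.

Lemma nocc_cons x s : nocc p (x :: s) = starts_with p (x :: s) + nocc p s.
Proof.
rewrite /nocc /= occurs_atE drop0; congr (_ + _).
rewrite -[2]/(1 + 1) iotaDl count_map; apply: eq_in_count => -[|i] //.
by rewrite mem_iota.
Qed.

Lemma order_invariant_nocc : order_invariant (nocc p).
Proof.
move=> f; elim=> [//|x s IH] f_mono.
rewrite map_cons !nocc_cons -map_cons order_invariant_starts_with // IH //.
by move=> a b a_s b_s; apply: f_mono; rewrite inE ?a_s ?b_s orbT.
Qed.

Lemma order_invariant_clusters_on q : order_invariant (clusters_on p q).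
Proof.
elim: q => [|q IH] f s f_mono /=; first by rewrite size_map.
rewrite order_invariant_starts_with //; congr (_ * _).
by apply: eq_bigr => d _; have /= -> := order_invariant_drop d IH f_mono.
Qed.

Lemma clusters_on_oversize q s : size s <= q -> clusters_on p q s = 0.
Proof.
elim: q s => [|q IH] s sq /=; first by case: s sq.
rewrite big_nat big1 ?muln0 // => d /andP[d0 _].
by apply: IH; rewrite size_drop; lia.
Qed.

Lemma clusters_on1 s :
  1 < size p -> clusters_on p 1 s = starts_with p s && (size s == size p).
Proof.
move=> p1 /=; case: (boolP (starts_with p s)) => //= /starts_with_size p_le_s.
rewrite mul1n -(@prednK (size p)) ?(ltnW p1) // big_nat_recr /= ?size_drop; last by lia.
rewrite big_nat big1 ?add0n => [|d d_lt]; last by rewrite size_drop; lia.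
by congr nat_of_bool; lia.
Qed.

End WordClusters.

(** * Splitting off the first cluster of a word *)

Section ClusterExpansion.
Local Open Scope ring_scope.
Variables (R : pzRingType) (y : R) (p : seq nat).
Hypothesis p_gt1 : (1 < size p)%N.

Definition cluster_weight (s : seq nat) : R :=
  \sum_(0 <= q < size s) y ^+ q *+ clusters_on p q s.

Lemma cluster_weight_widen N s : (size s <= N)%N ->
  cluster_weight s = \sum_(0 <= q < N) y ^+ q *+ clusters_on p q s.
Proof.
move=> sN; rewrite [RHS](@big_cat_nat _ _ _ (size s)) //=.
rewrite [X in _ + X]big_nat [X in _ + X]big1 ?addr0 // => q /andP[sq _].
by rewrite clusters_on_oversize.
Qed.

Lemma order_invariant_cluster_weight : order_invariant cluster_weight.
Proof.
move=> f s f_mono; rewrite /cluster_weight size_map.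
by apply: eq_bigr => q _; rewrite order_invariant_clusters_on.
Qed.

Lemma cluster_weight_rec s : cluster_weight s =
  (size s == 1)%:R
    + y * (\sum_(1 <= d < size p) cluster_weight (drop d s)) *+ starts_with p s.
Proof.
rewrite (@cluster_weight_widen (size s).+1) // big_nat_recl //=; congr (_ + _).
under [in RHS]eq_bigr do
  rewrite (@cluster_weight_widen (size s)) ?size_drop ?leq_subr //.
rewrite exchange_big /= mulr_sumr -sumrMnl; apply: eq_bigr => q _.
by rewrite sumrMnr mulrnAr -exprS -mulrnA mulnC.
Qed.

Lemma cluster_weight_short s :
  (size s < size p)%N -> cluster_weight s = (size s == 1)%:R.
Proof.
move=> sp; rewrite cluster_weight_rec.
have /negbTE -> : ~~ starts_with p s.
  by apply: contraTN sp => /starts_with_size; rewrite -leqNgt.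
by rewrite addr0.
Qed.

Section FixedWord.
Variable s : seq nat.

Definition suffix_weight (d : nat) : R := (1 + y) ^+ nocc p (drop d s).

Definition factor_weight (d m : nat) : R := cluster_weight (drop d (take m s)).

Definition factor_expansion (d : nat) : R :=
  \sum_(d.+1 <= m < (size s).+1) factor_weight d m * suffix_weight m.

Lemma suffix_weightS d : (d < size s)%N -> suffix_weight d =
  suffix_weight d.+1 + y * suffix_weight d.+1 *+ starts_with p (drop d s).
Proof.
move=> ds; rewrite /suffix_weight (drop_nth 0%N ds) nocc_cons exprD.
rewrite -(drop_nth 0%N ds); case: starts_with; last by rewrite mul1r addr0.
by rewrite expr1 mulrDl mul1r.
Qed.

Lemma factor_weight_short d m : (d < m <= size s)%N -> (m < d + size p)%N ->
  factor_weight d m = (m == d.+1)%:R.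
Proof.
move=> dm mdp.
rewrite /factor_weight cluster_weight_short size_drop size_takel; [|lia..].
by congr (nat_of_bool _)%:R; lia.
Qed.

Lemma factor_weight_rec d m : (d.+1 < m <= size s)%N -> factor_weight d m =
  y * (\sum_(d.+1 <= e < d + size p) factor_weight e m)
    *+ (starts_with p (drop d s) && (d + size p <= m)%N).
Proof.
move=> dm; rewrite /factor_weight cluster_weight_rec size_drop size_takel; last by lia.
have -> : (m - d == 1)%N = false by lia.
rewrite add0r -[d.+1]add1n big_addn addKn starts_with_factor; last by lia.
by under [in LHS]eq_bigr do rewrite drop_drop.
Qed.

Lemma factor_expansion_cat d b : (d < b <= (size s).+1)%N -> (b <= d + size p)%N ->
  factor_expansion d =
  (if (d.+1 < b)%N then suffix_weight d.+1 else 0)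
    + \sum_(b <= m < (size s).+1) factor_weight d m * suffix_weight m.
Proof.
move=> /andP[db bs] b_le; rewrite /factor_expansion (@big_cat_nat _ _ _ b) //=.
congr (_ + _); case: ltnP => [d1b|bd1]; last by rewrite big_geq.
rewrite big_ltn // factor_weight_short ?eqxx ?mul1r; [|lia..].
rewrite big_nat big1 ?addr0 // => m dm.
by rewrite factor_weight_short ?gtn_eqF ?mul0r //; lia.
Qed.

(* For [e] inside the occurrence, the part of [factor_expansion e] beyond its end
   is [suffix_weight e - suffix_weight e.+1], so the sum over [e] telescopes. *)
Lemma occurrence_expansion d : starts_with p (drop d s) ->
  (forall e, (d < e < size s)%N -> suffix_weight e = factor_expansion e) ->
  \sum_(d + size p <= m < (size s).+1) factor_weight d m * suffix_weight m =
  y * suffix_weight d.+1.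
Proof.
move=> starts_d expansion; have := starts_with_size starts_d; rewrite size_drop => ps.
transitivity (y * \sum_(d.+1 <= e < d + size p)
    \sum_(d + size p <= m < (size s).+1) factor_weight e m * suffix_weight m).
  rewrite exchange_big mulr_sumr /= big_nat [RHS]big_nat; apply: eq_bigr => m dm.
  rewrite factor_weight_rec; last by lia.
  have -> : (d + size p <= m)%N by lia.
  by rewrite starts_d -mulr_suml mulrA.
pose inner e := if (e < d + size p)%N then suffix_weight e else 0.
congr (y * _); rewrite (@telescope_sumr_eq _ _ _ (fun e => - inner e)) => [||e de].
- by rewrite /inner ltnn oppr0 sub0r opprK; case: ltnP => //; lia.
- by lia.
have -> : inner e = factor_expansion e.
  by rewrite /inner -expansion; [case: ltnP => //; lia | lia].
by rewrite opprK (@factor_expansion_cat e (d + size p)) ?addKr //; lia.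
Qed.

Lemma suffix_weight_expansion d :
  (d < size s)%N -> suffix_weight d = factor_expansion d.
Proof.
have [k] := ubnP (size s - d)%N; elim: k d => // k IH d dk ds.
rewrite suffix_weightS //; case: (boolP (starts_with p (drop d s))) => starts_d.
  have := starts_with_size starts_d; rewrite size_drop => ps.
  rewrite (@factor_expansion_cat d (d + size p)); [|lia..].
  rewrite occurrence_expansion //; last by move=> e de; apply: IH; lia.
  by have -> : (d.+1 < d + size p)%N by lia.
rewrite (@factor_expansion_cat d d.+2); [|lia..].
rewrite ltnSn big_nat [in RHS]big1 // => m dm.
by rewrite factor_weight_rec // (negbTE starts_d) mul0r.
Qed.

End FixedWord.

Lemma expr1D_nocc s : (0 < size s)%N ->
  (1 + y) ^+ nocc p s = \sum_(1 <= m < (size s).+1)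
    cluster_weight (take m s) * (1 + y) ^+ nocc p (drop m s).
Proof.
move/suffix_weight_expansion; rewrite /suffix_weight drop0 => ->.
by apply: eq_bigr => m _; rewrite /factor_weight drop0.
Qed.

End ClusterExpansion.

(** * Sums over permutations *)

Lemma ltn_bump2 v : {mono bump v : x y / x < y}.
Proof. exact: leqW_mono (leq_bump2 v). Qed.

Lemma enum_ordD m k :
  enum 'I_(m + k) =
  [seq lshift k i | i <- enum 'I_m] ++ [seq rshift m i | i <- enum 'I_k].
Proof.
apply: (inj_map val_inj); rewrite val_enum_ord iotaD map_cat.
congr (_ ++ _); first by rewrite -val_enum_ord -[RHS]map_comp.
by rewrite add0n -[m in iota m]addn0 iotaDl -val_enum_ord -[LHS]map_comp -[RHS]map_comp.
Qed.

Lemma nth_word n (s : 'S_n) (i : 'I_n) : nth 0 (word s) i = (s i).+1.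
Proof. by rewrite (nth_map i) ?size_enum_ord // nth_ord_enum. Qed.

Lemma mem_word n (s : 'S_n) x : (x \in word s) = (0 < x <= n).
Proof. by rewrite (perm_mem (word_perm s)) mem_iota; lia. Qed.

Lemma nth_word_bounds n (s : 'S_n) i : i < n -> 0 < nth 0 (word s) i <= n.
Proof. by move=> lt_in; rewrite -(mem_word s) mem_nth ?size_word. Qed.

Lemma word_min_head n (s : 'S_n.+1) :
  {in behead (word s), forall x, nth 0 (word s) 0 < x} -> nth 0 (word s) 0 = 1.
Proof.
have : 1 \in word s by rewrite mem_word.
have := @nth_word_bounds _ s 0 isT.
case: (word s) => // a t /= a0; rewrite inE => /orP[/eqP<- //|t1 /(_ _ t1)].
by lia.
Qed.

Lemma word_surj n s : is_perm_word n s -> exists g : 'S_n, word g = s.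
Proof.
rewrite /is_perm_word -[iota 1 n]/(val (iota_tuple n 1)) => /tuple_permP[g ->].
exists g; rewrite /= /word; apply: eq_map => i.
by rewrite (tnth_nth 0) nth_iota.
Qed.

Definition permute_word n (u : seq nat) (g : 'S_n) : seq nat :=
  [seq nth 0 u (g i) | i <- enum 'I_n].

Lemma size_permute_word n u (g : 'S_n) : size (permute_word u g) = n.
Proof. by rewrite size_map size_enum_ord. Qed.

Section BigWord.
Variables (R : Type) (idx : R) (op : Monoid.com_law idx).
Implicit Type F : seq nat -> R.

Lemma big_word_cons n F :
  \big[op/idx]_(s : 'S_n.+1) F (word s) =
  \big[op/idx]_(1 <= v < n.+2) \big[op/idx]_(s : 'S_n) F (v :: map (bump v) (word s)).
Proof.
pose insert (vs : 'I_n.+1 * 'S_n) := lift_perm ord0 vs.1 vs.2.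
have insert_inj : injective insert.
  move=> [v s] [w t] eq_ins; have eq_vw : v = w.
    rewrite -(lift_perm_id ord0 v s) -(lift_perm_id ord0 w t).
    by rewrite -/(insert (v, s)) eq_ins.
  subst w; congr pair; apply/permP => i; apply: (@lift_inj _ v).
  by rewrite -!(lift_perm_lift ord0) -/(insert (v, s)) eq_ins.
have insert_bij : bijective insert.
  by apply: inj_card_bij; rewrite // card_prod card_ord !card_Sn factS.
rewrite big_add1 big_mkord pair_big (reindex insert) /=; last exact: onW_bij.
apply: eq_bigr => -[v s] _; congr F.
rewrite /word enum_ordSl /= lift_perm_id -!map_comp; congr cons.
by apply: eq_map => i; rewrite /= lift_perm_lift bumpS.
Qed.

Lemma big_word_head1 n F :
  (forall s : 'S_n.+1, nth 0 (word s) 0 != 1 -> F (word s) = idx) ->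
  \big[op/idx]_(s : 'S_n.+1) F (word s) =
  \big[op/idx]_(s : 'S_n) F (1 :: map (bump 1) (word s)).
Proof.
move=> F_head; pose F1 s := if nth 0 s 0 == 1 then F s else idx.
transitivity (\big[op/idx]_(s : 'S_n.+1) F1 (word s)).
  by apply: eq_bigr => s _; rewrite /F1; case: eqP => // /eqP /F_head.
rewrite big_word_cons big_ltn // [X in op _ X]big_nat.
rewrite [X in op _ X]big1 ?Monoid.mulm1 // => v /andP[v1 _].
by apply: big1 => s _; rewrite /F1 /= gtn_eqF.
Qed.

Lemma big_permute_word n u F : order_invariant F -> uniq u -> size u = n ->
  \big[op/idx]_(g : 'S_n) F (permute_word u g) =
  \big[op/idx]_(g : 'S_n) F (word g).
Proof.
move=> F_inv uniq_u size_u.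
have := st_perm uniq_u; rewrite size_u => /word_surj[h word_h].
rewrite [RHS](reindex_inj (mulIg h)) /=; apply: eq_bigr => g _.
have sub_u x : x \in permute_word u g -> x \in u.
  by case/mapP=> i _ ->; rewrite mem_nth ?size_u.
rewrite -(F_inv (fun x => count (leq^~ x) u)); last first.
  by move=> x y /sub_u xu /sub_u yu; apply: st_ltn.
congr F; rewrite /permute_word /word -map_comp; apply: eq_map => i /=.
by rewrite permM -nth_word word_h (nth_map 0) ?size_u.
Qed.

End BigWord.

Definition block_fun m k (g : 'S_m) (h : 'S_k) (i : 'I_(m + k)) : 'I_(m + k) :=
  match split i with inl a => lshift k (g a) | inr b => rshift m (h b) end.

Lemma block_fun_inj m k (g : 'S_m) (h : 'S_k) : injective (block_fun g h).
Proof.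
apply: (can_inj (g := block_fun g^-1%g h^-1%g)) => i; rewrite /block_fun.
case: (split_ordP i) => [a ->|b ->].
  by rewrite (unsplitK (inl _)) permK.
by rewrite (unsplitK (inr _)) permK.
Qed.

Definition block_perm m k (g : 'S_m) (h : 'S_k) : 'S_(m + k) :=
  perm (@block_fun_inj m k g h).

Lemma word_block_perm m k (g : 'S_m) (h : 'S_k) (s : 'S_(m + k)) :
  word (block_perm g h * s)%g =
  permute_word (take m (word s)) g ++ permute_word (drop m (word s)) h.
Proof.
rewrite {1}/word enum_ordD map_cat; congr (_ ++ _);
  rewrite -[LHS]map_comp; apply: eq_map => i /=.
  rewrite permM permE /block_fun (unsplitK (inl _)) nth_take //.
  exact/esym/(nth_word s (lshift k (g i))).
rewrite permM permE /block_fun (unsplitK (inr _)) nth_drop.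
exact/esym/(nth_word s (rshift m (h i))).
Qed.

Section PermutationAverage.
Local Open Scope ring_scope.

(* Averaging over the action of ['S_m * 'S_k] on positions, which permutes
   ['S_(m + k)], decouples the two factors. *)
Lemma sum_word_split (R : pzSemiRingType) m k (F G : seq nat -> R) :
  order_invariant F -> order_invariant G ->
  (\sum_(s : 'S_(m + k)) F (take m (word s)) * G (drop m (word s))) *+ (m`! * k`!) =
  (\sum_(s : 'S_m) F (word s)) * (\sum_(s : 'S_k) G (word s)) *+ (m + k)`!.
Proof.
move=> F_inv G_inv.
transitivity (\sum_(gh : 'S_m * 'S_k) \sum_(s : 'S_(m + k))
    F (permute_word (take m (word s)) gh.1) * G (permute_word (drop m (word s)) gh.2)).
  rewrite -!card_Sn -card_prod -sumr_const; apply: eq_bigr => -[g h] _ /=.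
  rewrite (reindex_inj (mulgI (block_perm g h))) /=; apply: eq_bigr => s _.
  by rewrite word_block_perm take_size_cat ?drop_size_cat // size_permute_word.
rewrite exchange_big -card_Sn -sumr_const; apply: eq_bigr => s _ /=.
have uniq_s : uniq (word s) by rewrite (perm_uniq (word_perm s)) iota_uniq.
rewrite -(big_permute_word _ F_inv (take_uniq m uniq_s)); last first.
  by rewrite size_takel ?size_word ?leq_addr.
rewrite -(big_permute_word _ G_inv (drop_uniq m uniq_s)); last first.
  by rewrite size_drop size_word addKn.
by rewrite big_distrlr pair_big.
Qed.

Variables (K : numFieldType) (A : algType K).
Implicit Types F G : seq nat -> A.

Definition perm_avg (n : nat) F : A := (n`!%:R)^-1 *: \sum_(s : 'S_n) F (word s).

Lemma perm_avg_split m n F G : (m <= n)%N ->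
  order_invariant F -> order_invariant G ->
  perm_avg n (fun s => F (take m s) * G (drop m s)) =
  perm_avg m F * perm_avg (n - m) G.
Proof.
move=> le_mn F_inv G_inv; move: (n - m)%N (subnKC le_mn) => k <- {n le_mn}.
have fact_neq0 j : (j`!%:R : K) != 0 by rewrite Num.Theory.pnatr_eq0 -lt0n fact_gt0.
have mk_neq0 : (m`! * k`!)%:R != 0 :> K by rewrite natrM mulf_neq0.
rewrite /perm_avg -scalerAl -scalerAr scalerA -invfM -natrM.
apply: (scalerI mk_neq0); rewrite scalerA mulrC -scalerA scaler_nat sum_word_split //.
by rewrite -scaler_nat !scalerA mulVf ?mulfV.
Qed.

End PermutationAverage.

Lemma sum_expr_nocc (R : pzSemiRingType) (t : R) p n :
  (\sum_(s : 'S_n) t ^+ nocc p (word s) =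
   \sum_(0 <= k < n.+1) t ^+ k *+ num_perms_occ p n k)%R.
Proof.
have nocc_le (s : 'S_n) : nocc p (word s) < n.+1.
  by rewrite ltnS (leq_trans (count_size _ _)) // size_iota size_word.
rewrite big_mkord (partition_big (fun s => Ordinal (nocc_le s)) xpredT) //=.
apply: eq_bigr => k _; rewrite /num_perms_occ -sumr_const.
by apply: eq_big => s; rewrite ?inE // => /eqP <-.
Qed.

(** * Counting the clusters of a pattern *)

Definition cluster_total (p : seq nat) (n q : nat) : nat :=
  \sum_(s : 'S_n) clusters_on p q (word s).

Lemma cluster_total0 p n : cluster_total p n 0 = (n == 1).
Proof.
rewrite /cluster_total; under eq_bigr do rewrite /= size_word.
by rewrite sum_nat_const card_Sn; case: eqP => [->|_]; rewrite ?muln0.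
Qed.

Lemma cluster_total_oversize p n q : n <= q -> cluster_total p n q = 0.
Proof. by move=> nq; apply: big1 => s _; rewrite clusters_on_oversize ?size_word. Qed.

Lemma cluster_total_short p n q :
  n < size p -> n != 1 -> cluster_total p n q = 0.
Proof.
move=> np n1; apply: big1 => s _; case: q => [|q] /=.
  by rewrite size_word (negbTE n1).
by case: (boolP (starts_with p _)) => // /starts_with_size; rewrite size_word leqNgt np.
Qed.

Lemma big_tuple_cons (R : Type) (idx : R) (op : Monoid.com_law idx)
    (T : finType) q (F : seq T -> R) :
  \big[op/idx]_(t : q.+1.-tuple T) F t =
  \big[op/idx]_(x : T) \big[op/idx]_(t : q.-tuple T) F (x :: t).
Proof.
pose cons_pair (xt : T * q.-tuple T) := [tuple of xt.1 :: xt.2].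
rewrite pair_big (reindex cons_pair) //=; apply: onW_bij.
exists (fun t => (thead t, [tuple of behead t])) => [[x t]|t].
  by congr pair; apply: val_inj.
by rewrite /cons_pair -tuple_eta.
Qed.

Section CountClusters.
Variable p : seq nat.

Definition overlap : rel nat := fun i j => i < j < i + size p.

Definition cluster_from (s : seq nat) (i : nat) (js : seq nat) : bool :=
  [&& path overlap i js, all (occurs_at p s) (i :: js)
    & size s == last i js + size p - 1].

Lemma cluster_from_cons s i j js :
  cluster_from s i (j :: js) =
  [&& occurs_at p s i, overlap i j & cluster_from s j js].
Proof.
rewrite /cluster_from /=; case: (occurs_at p s i) => /=; last by rewrite andbF.
by rewrite -andbA.
Qed.

Lemma is_cluster_single s q i js : size js = q ->
  is_cluster [:: p] s (nseq q.+1 p) (i :: js) =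
  [&& is_perm_word (size s) s, i == 1 & cluster_from s i js].
Proof.
move=> size_js; rewrite /is_cluster; cbv beta zeta.
rewrite size_nseq [size (i :: js)]/= size_js eqxx.
have nth_p k : k < q.+1 -> nth [::] (nseq q.+1 p) k = p by rewrite nth_nseq => ->.
have -> : all (mem [:: p]) (nseq q.+1 p).
  by rewrite all_nseq; apply/orP; right; apply: mem_head.
have -> : all (fun k => occurs_at (nth [::] (nseq q.+1 p) k) s (nth 0 (i :: js) k))
    (iota 0 q.+1) = all (occurs_at p s) (i :: js).
  rewrite -[in RHS](mkseq_nth 0 (i :: js)) [RHS]all_map [size _]/= size_js.
  by apply: eq_in_all => k; rewrite mem_iota => /nth_p ->.
have -> : all (fun k => nth 0 (i :: js) k < nth 0 (i :: js) k.+1 <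
    nth 0 (i :: js) k + size (nth [::] (nseq q.+1 p) k)) (iota 0 q.+1.-1) =
    path overlap i js.
  apply/allP/(pathP 0) => gaps k; rewrite ?size_js ?mem_iota => kq.
    have := gaps k; rewrite mem_iota kq nth_p; [exact | exact: ltnW].
  by rewrite nth_p; [apply: gaps; rewrite size_js | exact: ltnW].
rewrite /= nth_p // -size_js nth_last /cluster_from.
by case: is_perm_word; case: (i == 1); rewrite /= ?andbF // andbCA.
Qed.

Lemma sum_overlap n i F : i + size p <= n.+1 ->
  \sum_(j < n.+1 | overlap i j) F (val j) = \sum_(1 <= d < size p) F (d + i).
Proof.
move=> le_n; rewrite -(big_mkord (overlap i) F) /= -[in RHS](addnK i (size p)).
rewrite -(big_addn _ _ _ predT) [RHS](@big_nat_widenl _ _ _ _ 0) //.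
rewrite [RHS](@big_nat_widen _ _ _ _ _ n.+1); last by rewrite addnC.
by apply: eq_bigl => j; rewrite /overlap add1n addnC.
Qed.

Hypothesis p_gt1 : 1 < size p.

Lemma sum_cluster_from s q n i : size s = n -> 0 < i ->
  \sum_(t : q.-tuple 'I_n.+1) cluster_from s i (map val t) =
  clusters_on p q.+1 (drop i.-1 s).
Proof.
move=> size_s; elim: q i => [|q IH] i i0.
  rewrite (big_pred1 [tuple]) => [|t]; last by apply/esym/eqP/val_inj; case: t => -[].
  rewrite clusters_on1 // /cluster_from /= andbT size_drop size_s occurs_atE i0 /=.
  case: (boolP (starts_with p _)) => //= /starts_with_size; rewrite size_drop size_s.
  by move=> ?; congr nat_of_bool; lia.
rewrite (big_tuple_cons _ _ (fun t => cluster_from s i (map val t) : nat)).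
transitivity (occurs_at p s i * \sum_(j < n.+1 | overlap i j)
    clusters_on p q.+1 (drop (val j).-1 s)).
  rewrite big_distrr [RHS]big_mkcond; apply: eq_bigr => j _ /=.
  under eq_bigr => t _ do rewrite cluster_from_cons.
  case: (boolP (overlap i j)) => [/andP[ij _]|_]; last first.
    by apply: big1 => t _; rewrite andbF.
  rewrite -/(clusters_on p q.+1 _) -IH; last exact: leq_ltn_trans ij.
  by rewrite big_distrr; apply: eq_bigr => t _; rewrite /= mulnb.
rewrite occurs_atE i0 /=; case: (boolP (starts_with p _)) => //= starts_i.
have := starts_with_size starts_i; rewrite size_drop size_s => ps.
rewrite (sum_overlap (fun j => clusters_on p q.+1 (drop j.-1 s))); last by lia.
congr (_ * _); rewrite big_nat [RHS]big_nat; apply: eq_bigr => d d0.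
by rewrite drop_drop -/(clusters_on p q.+1 _) -subn1 -addnBA // subn1.
Qed.

Lemma sum_is_cluster_single n (s : 'S_n) q :
  \sum_(t : q.+1.-tuple 'I_n.+1)
     is_cluster [:: p] (word s) (nseq q.+1 p) (map val t) =
  clusters_on p q.+1 (word s).
Proof.
rewrite (big_tuple_cons _ _ (fun t =>
  is_cluster [:: p] (word s) (nseq q.+1 p) (map val t) : nat)).
transitivity (\sum_(i < n.+1 | i == 1 :> nat)
    clusters_on p q.+1 (drop i.-1 (word s))).
  rewrite [RHS]big_mkcond; apply: eq_bigr => i _ /=.
  under eq_bigr => t _ do
    rewrite is_cluster_single ?size_word ?word_perm ?size_map ?size_tuple //=.
  case: eqP => [i1|_]; last by rewrite big1.
  by rewrite (sum_cluster_from q (size_word s)) ?i1.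
case: n s => [|n] s.
  by rewrite big1 ?clusters_on_oversize ?size_word // => i /eqP; case: i => -[].
by rewrite (big_pred1 (lift ord0 ord0)) // drop0.
Qed.

Lemma num_clusters_single n q :
  num_clusters [:: p] n q.+1 = cluster_total p n q.+1.
Proof.
have card_pis : #|{: q.+1.-tuple (seq_sub [:: p])}| == 1.
  by rewrite card_tuple card_seq_sub // exp1n.
have [pis0 all_pis0] := fintype1P card_pis.
have pis0E : map val pis0 = nseq q.+1 p.
  rewrite -[X in nseq X](size_tuple pis0) -(size_map val).
  by apply/all_pred1P/allP => _ /mapP[x _ ->]; have := valP x; rewrite inE.
pose add_patterns (c : 'S_n * q.+1.-tuple 'I_n.+1) := (c.1, pis0, c.2).
rewrite /num_clusters -sum1_card big_mkcond (reindex add_patterns) /=.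
  rewrite /cluster_total; under [RHS]eq_bigr do rewrite -sum_is_cluster_single.
  rewrite [RHS]pair_big; apply: eq_bigr => c _.
  by rewrite inE /= pis0E; case: is_cluster.
exists (fun c => (c.1.1, c.2)) => [[s t] //|[[s pis] t] _] /=.
by rewrite /add_patterns (all_pis0 pis).
Qed.

End CountClusters.

(** * The cluster theorem *)

Section FPSInverse.
Local Open Scope ring_scope.
Variable R : comUnitRingType.
Implicit Types d e f : nat -> R.

Lemma eq_fps_inv d e : d =1 e -> fps_inv d =1 fps_inv e.
Proof.
move=> de n; rewrite /fps_inv; congr _`_n.
elim: n.+1 => //= -[|m] ->; rewrite de //.
by under eq_bigr do rewrite de.
Qed.

Lemma fps_inv_renewal e f : f 0%N = 0 -> e 0%N = 1 ->
  (forall n, e n.+1 = \sum_(1 <= m < n.+2) f m * e (n.+1 - m)%N) ->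
  e =1 fps_inv (@fps1 R \- f).
Proof.
move=> f0 e0 e_rec; have d0 : (@fps1 R \- f) 0%N = 1 by rewrite /= f0 subr0.
apply: fps_inv_unique => [|n]; first by rewrite d0 unitr1.
rewrite fps_mulC /fps_mul big_ord_recl d0 mul1r subn0.
case: n => [|n]; first by rewrite big_ord0 e0 addr0.
rewrite e_rec big_add1 big_mkord -big_split /= big1 // => i _.
by rewrite /fps1 /= /bump /= add1n sub0r mulNr subrr.
Qed.

End FPSInverse.

Section ClusterTheorem.
Local Open Scope ring_scope.
Variables (K : numFieldType) (A : comUnitAlgType K) (y : A) (p : seq nat).
Hypothesis p_gt1 : (1 < size p)%N.

Definition occurrence_gf (n : nat) : A := perm_avg n (fun s => (1 + y) ^+ nocc p s).

Definition cluster_gf (n : nat) : A :=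
  (n`!%:R)^-1 *: \sum_(1 <= q < n.+1) y ^+ q *+ num_clusters [:: p] n q.

Lemma perm_avg_cluster_weight n :
  perm_avg n (cluster_weight y p) = @fpsX A n + cluster_gf n.
Proof.
have -> : perm_avg n (cluster_weight y p) =
    (n`!%:R)^-1 *: \sum_(0 <= q < n.+1) y ^+ q *+ cluster_total p n q.
  congr (_ *: _); under [in RHS]eq_bigr do rewrite -sumrMnr.
  rewrite [RHS]exchange_big; apply: eq_bigr => s _.
  by rewrite (@cluster_weight_widen _ _ _ n.+1) // size_word.
rewrite big_ltn // cluster_total0 scalerDr; congr (_ + _).
  by rewrite /fpsX; case: eqP => [->|_]; rewrite ?invr1 ?scale1r // scaler0.
rewrite big_nat [in RHS]/cluster_gf [in RHS]big_nat.
by congr (_ *: _); apply: eq_bigr => -[|q] // _; rewrite num_clusters_single.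
Qed.

Lemma occurrence_gf0 : occurrence_gf 0 = 1.
Proof.
rewrite /occurrence_gf /perm_avg invr1 scale1r.
under eq_bigr => s _ do rewrite (size0nil (size_word s)) expr0.
by rewrite sumr_const card_Sn.
Qed.

Lemma occurrence_gf_rec n : occurrence_gf n.+1 =
  \sum_(1 <= m < n.+2) (@fpsX A m + cluster_gf m) * occurrence_gf (n.+1 - m)%N.
Proof.
transitivity (perm_avg n.+1 (fun s => \sum_(1 <= m < n.+2)
    cluster_weight y p (take m s) * (1 + y) ^+ nocc p (drop m s))).
  by congr (_ *: _); apply: eq_bigr => s _; rewrite expr1D_nocc ?size_word.
rewrite /perm_avg exchange_big scaler_sumr /= big_nat [RHS]big_nat.
apply: eq_bigr => m /andP[_ mn]; rewrite -perm_avg_cluster_weight.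
apply: (@perm_avg_split _ _ _ _ (cluster_weight y p)
  (fun s => (1 + y) ^+ nocc p s)) => //.
  exact: order_invariant_cluster_weight.
by move=> f s f_mono; rewrite order_invariant_nocc.
Qed.

Lemma goulden_jackson :
  occurrence_gf =1 fps_inv (@fps1 A \- @fpsX A \- cluster_gf).
Proof.
have f0 : @fpsX A 0 + cluster_gf 0 = 0.
  by rewrite /fpsX /cluster_gf big_geq // scaler0 addr0.
move=> n; rewrite (fps_inv_renewal f0 occurrence_gf0 occurrence_gf_rec).
by apply: eq_fps_inv => m; rewrite /= opprD addrA.
Qed.

End ClusterTheorem.

(** * The second letter of a 1423-cluster *)

Lemma starts_with1423 s : starts_with p1423 s =
  [&& 3 < size s, nth 0 s 0 < nth 0 s 2, nth 0 s 2 < nth 0 s 3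
    & nth 0 s 3 < nth 0 s 1].
Proof.
rewrite /starts_with.
case: s => [|a [|b [|c [|d s]]]]; only 1-4: by apply/eqP => -[].
rewrite /= take0 /st /p1423 /=.
apply/eqP/and3P => [[] *|[ac cd db]]; first by split; lia.
by do 4?[congr cons]; lia.
Qed.

Lemma starts_with1423_drop1 s :
  starts_with p1423 s -> ~~ starts_with p1423 (drop 1 s).
Proof.
rewrite !starts_with1423 => /and4P[_ _ _ s31]; apply/negP => /and4P[_ + _ _].
by rewrite !nth_drop ltnNge ltnW.
Qed.

Lemma clusters_on1423S q s : clusters_on p1423 q.+1 s =
  starts_with p1423 s *
    (clusters_on p1423 q (drop 2 s) + clusters_on p1423 q (drop 3 s)).
Proof.
rewrite /= 3?big_ltn // big_geq // addn0.
case: (boolP (starts_with _ s)) => // starts_s; rewrite !mul1n.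
suff -> : clusters_on p1423 q (drop 1 s) = 0 by [].
case: q => [|q] /=; last by rewrite (negbTE (starts_with1423_drop1 starts_s)).
by have /= := starts_with_size starts_s; rewrite size_drop; lia.
Qed.

Lemma clusters_on1423_min q s : 0 < clusters_on p1423 q s ->
  {in behead s, forall x, nth 0 s 0 < x}.
Proof.
elim: q s => [|q IH] s; first by case: s => [|? [|]].
rewrite clusters_on1423S muln_gt0 lt0b addn_gt0 starts_with1423 => /andP[].
case: s => [|a [|b [|c [|d s]]]] // /and3P[/= ac cd db] tail_min x.
rewrite !inE => /or4P[/eqP->|/eqP->|/eqP->|xs]; [lia|lia|lia|].
by case/orP: tail_min => /IH /= /(_ x); rewrite ?inE xs ?orbT => /(_ isT); lia.
Qed.

Lemma word_cluster1423_head n (s : 'S_n) q :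
  0 < clusters_on p1423 q (word s) -> nth 0 (word s) 0 = 1.
Proof.
case: n s => [|n] s; last by move/clusters_on1423_min/word_min_head.
by rewrite clusters_on_oversize ?size_word.
Qed.

Lemma clusters_on_bump p q v s :
  clusters_on p q (map (bump v) s) = clusters_on p q s.
Proof. by apply: order_invariant_clusters_on; apply: in2W (ltn_bump2 v). Qed.

Lemma clusters_on1423_cons2 q v w : 0 < v -> 0 < nth 0 w 0 -> 1 < size w ->
  clusters_on p1423 q.+1 (1 :: map (bump 1) (v :: map (bump v) w)) =
  (nth 0 w 0 < nth 0 w 1 < v) *
    (clusters_on p1423 q w + clusters_on p1423 q (drop 1 w)).
Proof.
move=> v0 w0 w1; rewrite clusters_on1423S [drop 2 _]/= [drop 3 _]/= drop0.
rewrite -!map_drop !clusters_on_bump; congr (nat_of_bool _ * _).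
rewrite starts_with1423.
by case: w w0 w1 => [|a [|b w]] //= a0 _; rewrite !ltn_bump2 /bump; lia.
Qed.

Definition cluster_total_second_lt (p : seq nat) (n q j : nat) : nat :=
  \sum_(s : 'S_n) clusters_on p q (word s) * (nth 0 (word s) 1 < j).

Lemma cluster_total_second_lt_eq0 p n q j :
  cluster_total p n q = 0 -> cluster_total_second_lt p n q j = 0.
Proof.
move/eqP; rewrite sum_nat_eq0 => /forallP total0; apply: big1 => s _.
by rewrite (eqP (implyP (total0 s) isT)).
Qed.

Lemma cluster_total_second_ltT p n q :
  1 < n -> cluster_total_second_lt p n q n.+1 = cluster_total p n q.
Proof.
move=> n1; apply: eq_bigr => s _; have /andP[_ second_le] := nth_word_bounds s n1.
by rewrite ltnS second_le muln1.
Qed.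

Lemma sum_clusters_on1423_drop1 m q v : 0 < m ->
  \sum_(s : 'S_m.+1) (nth 0 (word s) 0 < nth 0 (word s) 1 < v) *
     clusters_on p1423 q (drop 1 (word s)) =
  (2 < v) * cluster_total p1423 m q.
Proof.
move=> m0; pose F w := (nth 0 w 0 < nth 0 w 1 < v) * clusters_on p1423 q (drop 1 w).
rewrite (big_word_head1 _ (F := F)) => [|s].
  rewrite /cluster_total big_distrr; apply: eq_bigr => s _; rewrite /F /=.
  rewrite drop0 clusters_on_bump.
  case: (posnP (clusters_on p1423 q (word s))) => [->|/word_cluster1423_head head1].
    by rewrite !muln0.
  by rewrite (nth_map 0) ?size_word // head1.
apply: contraNeq; rewrite muln_eq0 negb_or eqb0 negbK -lt0n.
case/andP=> /andP[lt01 _] /clusters_on1423_min tail_min; apply/eqP/word_min_head.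
case: (word s) lt01 tail_min => [|a [|b w]] //= ab tail_min x.
by rewrite inE => /orP[/eqP-> //|/tail_min]; lia.
Qed.

(* Without its first two letters [1] and [v+1], a 1423-cluster is a word [w] with
   [w_0 < w_1 < v] such that [w] or [drop 1 w] is again a cluster. *)
Lemma sum_clusters_on1423_cons2 m q v : 1 < m -> 0 < v ->
  \sum_(s : 'S_m)
     clusters_on p1423 q.+1 (1 :: map (bump 1) (v :: map (bump v) (word s))) =
  cluster_total_second_lt p1423 m q v + (2 < v) * cluster_total p1423 m.-1 q.
Proof.
case: m => // m m1 v0.
under eq_bigr => s _.
  have /andP[head0 _] := nth_word_bounds s (ltn0Sn m).
  rewrite clusters_on1423_cons2 ?size_word // mulnDr; over.
rewrite big_split /= sum_clusters_on1423_drop1 //; congr (_ + _).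
apply: eq_bigr => s _.
case: (posnP (clusters_on p1423 q (word s))) => [->|cluster_s]; first by rewrite muln0.
rewrite mulnC; congr (_ * nat_of_bool _); rewrite andb_idl // => _.
apply: (clusters_on1423_min cluster_s).
by rewrite -nth_behead mem_nth // size_behead size_word.
Qed.

Lemma cluster_total_second_lt1423_rec m q j : 1 < m -> j <= m.+3 ->
  cluster_total_second_lt p1423 m.+2 q.+1 j =
  \sum_(1 <= v < j.-1)
    (cluster_total_second_lt p1423 m q v + (2 < v) * cluster_total p1423 m.-1 q).
Proof.
move=> m1 jm; pose F s := clusters_on p1423 q.+1 s * (nth 0 s 1 < j).
rewrite /cluster_total_second_lt (big_word_head1 _ (F := F)) => [|s]; last first.
  apply: contraNeq; rewrite muln_eq0 negb_or -lt0n => /andP[cluster_s _].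
  by rewrite (word_cluster1423_head cluster_s).
rewrite (big_word_cons _ _ (fun s => F (1 :: map (bump 1) s))).
rewrite [RHS](@big_nat_widen _ _ _ _ _ m.+2) ?[RHS]big_mkcond; last by lia.
rewrite big_nat [RHS]big_nat; apply: eq_bigr => v /andP[v0 _].
transitivity ((\sum_(s : 'S_m) clusters_on p1423 q.+1
    (1 :: map (bump 1) (v :: map (bump v) (word s)))) * (bump 1 v < j)).
  by rewrite big_distrl.
rewrite sum_clusters_on1423_cons2 //=.
have -> : (bump 1 v < j) = (v < j.-1) by rewrite /bump; lia.
by case: (v < j.-1); rewrite ?muln1 ?muln0.
Qed.

Lemma sum_bin_subn a c n k : a <= c ->
  \sum_(a <= v < n) (c <= v) * 'C(v - c, k) = 'C(n - c, k.+1).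
Proof.
move=> ac; transitivity (\sum_(c <= v < n) 'C(v - c, k)).
  rewrite (@big_nat_widenl _ _ _ c a) // [RHS]big_mkcond.
  by apply: eq_bigr => v _; rewrite /=; case: (c <= v); rewrite ?mul1n.
rewrite -{1}[c]add0n big_addn big_mkord.
under eq_bigr do rewrite addnK.
elim: (n - c) => [|l IH]; first by rewrite big_ord0.
by rewrite big_ord_recr /= IH binS.
Qed.

Lemma cluster_total_second_lt1423E n q j : 1 < n -> j <= n.+1 ->
  cluster_total_second_lt p1423 n q j =
  \sum_(1 <= k < q.+1)
    'C(j - k - 3, k) * cluster_total p1423 (n - 2 * k - 1) (q - k).
Proof.
elim: q n j => [|q IH] n j n1 jn.
  by rewrite big_geq // cluster_total_second_lt_eq0 // cluster_total0 gtn_eqF.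
case: (ltnP n 4) => n4.
  rewrite cluster_total_second_lt_eq0 ?cluster_total_short ?gtn_eqF //.
  rewrite big_nat big1 // => k k0.
  by rewrite cluster_total_short ?muln0 /=; lia.
case: n n1 n4 jn => [|[|m]] // _ n4 jn.
rewrite cluster_total_second_lt1423_rec // big_split /= addnC.
rewrite [RHS]big_ltn // [in RHS]big_add1; congr (_ + _).
  rewrite -big_distrl; congr (_ * cluster_total _ _ _); [|lia..].
  have -> : j - 1 - 3 = j.-1 - 3 by lia.
  by rewrite -(@sum_bin_subn 1) //; apply: eq_bigr => v _; rewrite bin0 muln1.
transitivity (\sum_(1 <= v < j.-1) \sum_(1 <= k < q.+1)
    'C(v - k - 3, k) * cluster_total p1423 (m - 2 * k - 1) (q - k)).
  by rewrite big_nat [RHS]big_nat; apply: eq_bigr => v vj; apply: IH; lia.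
rewrite exchange_big /= big_nat [RHS]big_nat; apply: eq_bigr => k k0.
rewrite -big_distrl; congr (_ * cluster_total _ _ _); [|lia..].
have -> : j - k.+1 - 3 = j.-1 - (k + 3) by lia.
rewrite -(@sum_bin_subn 1); last by lia.
apply: eq_bigr => v _; rewrite subnDA; case: leqP => vk; first by rewrite mul1n.
by rewrite bin_small //; lia.
Qed.

(** * Cluster numbers and generating functions of 1423 *)

Lemma c1423E n q : 0 < n -> c1423 n q%:Z = cluster_total p1423 n q.
Proof.
move=> n0; rewrite /c1423; case: eqP => [->|/eqP n1].
  case: q => [|q]; first by rewrite cluster_total0.
  by rewrite cluster_total_oversize.
case: q => [|q]; first by rewrite cluster_total0 (negbTE n1).
by rewrite num_clusters_single.
Qed.

Lemma c1423_neg n (l : int) : (l < 0)%R -> c1423 n l = 0.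
Proof. by case: l => // l _; rewrite /c1423; case: (n == 1). Qed.

Lemma c1423_short n (l : int) : 1 < n < 4 -> c1423 n l = 0.
Proof.
case: l => [q|q] n14; last exact: c1423_neg.
by rewrite c1423E ?cluster_total_short /=; lia.
Qed.

Lemma c1423_rec n (l : int) : 4 <= n ->
  c1423 n l =
  \sum_(1 <= k < n | 2 * k + 2 <= n)
     'C(n - k - 2, k) * c1423 (n - 2 * k - 1) (l - k%:Z)%R.
Proof.
case: l => [q|q] n4; last first.
  rewrite c1423_neg // big_nat_cond big1 // => k k0.
  by rewrite c1423_neg ?muln0 //; lia.
rewrite c1423E -?cluster_total_second_ltT ?cluster_total_second_lt1423E; [|lia..].
rewrite (@big_nat_widen _ _ _ _ _ (n + q.+1)) ?leq_addl //.
rewrite [RHS](@big_nat_widen _ _ _ _ _ (n + q.+1)) ?leq_addr //.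
rewrite big_mkcond [RHS]big_mkcond big_nat [RHS]big_nat.
apply: eq_bigr => k /andP[k0 _].
have -> : n.+1 - k - 3 = n - k - 2 by lia.
case: (leqP (2 * k + 2) n) => kn /=; last first.
  by rewrite cluster_total_short ?muln0 ?if_same /=; lia.
have -> : k < n by lia.
case: ltnP => kq; last by rewrite c1423_neg ?muln0 //; lia.
by rewrite subzn // c1423E //; lia.
Qed.

Section GeneratingFunctions.
Local Open Scope ring_scope.

Lemma Pi1423E : Pi1423 =1 occurrence_gf ('X - 1 : {poly rat}) p1423.
Proof.
move=> n; rewrite /Pi1423 /occurrence_gf /perm_avg addrC subrK sum_expr_nocc.
by congr (_ *: _); apply: eq_bigr => k _; rewrite scaler_nat.
Qed.

Lemma C1423E : C1423 =1 cluster_gf ('X - 1 : {poly rat}) p1423.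
Proof.
move=> n; rewrite /C1423 /cluster_gf; case: ltnP => n2.
  congr (_ *: _); rewrite big_nat [RHS]big_nat; apply: eq_bigr => -[|l] // _.
  by rewrite scaler_nat /c1423 gtn_eqF.
rewrite big_nat big1 ?scaler0 // => -[|l] // ln.
by rewrite num_clusters_single // cluster_total_oversize ?mulr0n //; lia.
Qed.

Lemma Pi1423_fps_inv :
  Pi1423 =1 fps_inv (@fps1 {poly rat} \- @fpsX {poly rat} \- C1423).
Proof.
move=> n; rewrite Pi1423E goulden_jackson //.
by apply: eq_fps_inv => m; rewrite /= C1423E.
Qed.

End GeneratingFunctions.

Theorem theorem1423 :
  (forall l : int, c1423 2 l = 0 /\ c1423 3 l = 0) /\
  (forall (n : nat) (l : int), 4 <= n ->
     c1423 n l =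
     \sum_(1 <= k < n | 2 * k + 2 <= n)
        'C(n - k - 2, k) * c1423 (n - 2 * k - 1) (l - k%:Z)%R) /\
  Pi1423 =1 fps_inv (@fps1 {poly rat} \- @fpsX {poly rat} \- C1423)%R.
Proof.
split=> [l|]; first by rewrite !c1423_short.
by split; [exact: c1423_rec | exact: Pi1423_fps_inv].
Qed.
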